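(* Let $w\in\mathbb{Q}$ with $0<w\le 1$, let $z\ge 1$, and let $C=\{c_1,\dots,c_{z-1},c^*\}$ be a set of $z$ candidates. Let $N_1,N_2$ be two non-manipulators with arbitrary votes (total orders on $C$), where $N_1$'s vote has weight $w$ and $N_2$'s vote has weight $1$, and let $M_1,M_2$ be two manipulators whose votes have weight $1$. Suppose that the votes of the manipulators are produced by the Respective REVERSE algorithm: for $j=1,2$, $M_j$'s vote is obtained by reversing $N_j$'s vote and then moving $c^*$ to the first place (keeping the relative order of all other candidates). Then, under the (weighted) Borda rule, $c^*$ is one of the winners, i.e. no other candidate has a total score strictly greater than the total score of $c^*$.
   Context: Borda rule with $z$ candidates: a vote is a total order of the candidates; a vote of weight $\omega$ gives the candidate ranked $k$-th a score of $\omega\,(z-k)$, $k=1,\dots,z$. The total score of a candidate is the sum of the scores it receives from all voters; the winners are the candidates with the highest total score (a tie is broken uniformly at random). Here the voters are $N_1$ (weight $w$), $N_2,M_1,M_2$ (weight $1$ each). *)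

(* Defs.v *)
From mathcomp Require Import all_boot all_order all_algebra.

Set Implicit Arguments.
Unset Strict Implicit.
Unset Printing Implicit Defensive.

Import Order.TTheory GRing.Theory Num.Theory.
Local Open Scope ring_scope.

Section Votes.
Variable C : finType.

(* For a vote v, [v a b] reads "a is ranked at least as high as b". *)
Definition is_vote (v : rel C) : Prop :=
  [/\ reflexive v, antisymmetric v, transitive v & total v].

(* Positions are numbered from 1: since v is reflexive, c counts itself. *)
Definition position (v : rel C) (c : C) : nat := #|[set d | v d c]|.

Definition reverse_vote (v : rel C) : rel C := fun a b => v b a.

Definition move_first (x : C) (v : rel C) : rel C :=
  fun a b => (a == x) || (b != x) && v a b.

Definition respective_reverse (x : C) (v : rel C) : rel C :=
  move_first x (reverse_vote v).

Lemma respective_reverse_is_vote x v :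
  is_vote v -> is_vote (respective_reverse x v).
Proof.
case=> vr va vt vT; rewrite /respective_reverse /move_first /reverse_vote.
split.
- by move=> a; rewrite vr andbT orbN.
- move=> a b; case: (eqVneq a x) => [->|ax]; case: (eqVneq b x) => [->|bx] //=.
  by rewrite andbC; exact: va.
- move=> b a c; case: (eqVneq a x) => [->//|ax] /=.
  case: (eqVneq b x) => [//|bx] /=; case: (eqVneq c x) => [//|cx] /= vba vcb.
  exact: vt vcb vba.
- move=> a b; case: (eqVneq a x) => [->//|ax]; case: (eqVneq b x) => [//|bx] /=.
  exact: vT.
Qed.

Definition borda_score (w : rat) (v : rel C) (c : C) : rat :=
  w * (#|C|%:R - (position v c)%:R).

(* A profile lists the voters, each given by a weight and a vote. *)
Definition total_score (p : seq (rat * rel C)) (c : C) : rat :=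
  \sum_(b <- p) borda_score b.1 b.2 c.

Definition borda_winners (p : seq (rat * rel C)) : {set C} :=
  [set c | [forall d, total_score p d <= total_score p c]].

End Votes.

(* Main.v *)
Require Import Defs.
From mathcomp Require Import all_boot all_order all_algebra.
From mathcomp Require Import lra.

(* Every candidate d other than c* earns at most position N_j d - 1 points from
   M_j, hence at most z - 1 points from the pair N_2, M_2; and, as w <= 1, it
   also earns at most
     w (z - position N_1 d) + position N_1 d - 1 <= z - 1
   points from the pair N_1, M_1.  Being first in M_1 and M_2, c* gets
   2 (z - 1) from the manipulators alone. *)

Import Order.TTheory GRing.Theory Num.Theory.
Local Open Scope ring_scope.

Lemma eq_position (C : finType) (v v' : rel C) (c : C) :
  v =2 v' -> position v c = position v' c.
Proof. by move=> eqv; apply: eq_card => d; rewrite !inE eqv. Qed.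

Lemma position_le_card (C : finType) (v : rel C) (c : C) :
  (position v c <= #|C|)%N.
Proof. exact: max_card. Qed.

Lemma position_respective_reverse_first (C : finType) (x : C) (v : rel C) :
  position (respective_reverse x v) x = 1%N.
Proof.
rewrite -(cards1 x); apply: eq_card => d.
by rewrite !inE /respective_reverse /move_first eqxx orbF.
Qed.

(** By totality the candidates weakly above [c] and those weakly below it cover [C]; by antisymmetry
    only [c] is counted twice. *)
Lemma position_add_reverse (C : finType) (v : rel C) (c : C) :
  is_vote v -> (position v c + position (reverse_vote v) c)%N = #|C|.+1.
Proof.
case=> vr va _ vT; rewrite /position -cardsUI -addn1; congr addn.
  by apply: eq_card => e; rewrite !inE /reverse_vote vT.
rewrite -(cards1 c); apply: eq_card => e; rewrite !inE /reverse_vote.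
by apply/idP/eqP => [/va|->]; rewrite ?vr.
Qed.

(** Moving [x] to the top can only add [x] to the candidates ranked at or above [c]. *)
Lemma position_reverse_le (C : finType) (x c : C) (v : rel C) :
  c != x ->
  (position (reverse_vote v) c <= position (respective_reverse x v) c)%N.
Proof.
move=> cx; apply/subset_leq_card/subsetP => e; rewrite !inE => ve.
by rewrite /respective_reverse /move_first cx ve orbT.
Qed.

Theorem theorem1 (w : rat) (hw0 : 0 < w) (hw1 : w <= 1)
    (z : nat) (hz : (1 <= z)%N) (C : finType) (hC : #|C| = z) (cstar : C)
    (N1 N2 M1 M2 : rel C)
    (hN1 : is_vote N1) (hN2 : is_vote N2)
    (hM1 : M1 =2 respective_reverse cstar N1)
    (hM2 : M2 =2 respective_reverse cstar N2) :
  cstar \in borda_winners [:: (w, N1); (1, N2); (1, M1); (1, M2)].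
Proof.
rewrite inE; apply/forallP => d; have [->//|dx] := eqVneq d cstar.
rewrite /total_score !big_cons !big_nil /borda_score /=.
rewrite !(eq_position _ _ _ _ hM1) !(eq_position _ _ _ _ hM2).
rewrite !position_respective_reverse_first.
have le_card (v : rel C) c : (position v c)%:R <= #|C|%:R :> rat.
  by rewrite ler_nat position_le_card.
have ge_rev (v : rel C) : is_vote v -> #|C|%:R + 1 <=
    (position v d)%:R + (position (respective_reverse cstar v) d)%:R :> rat.
  move=> hv; rewrite natr1 -natrD ler_nat -(position_add_reverse _ _ d hv).
  by rewrite leq_add2l position_reverse_le.
have := ge_rev _ hN1; have := ge_rev _ hN2.
(* The points of [cstar] from [N2], then from [N1], enter only through being nonnegative. *)
have := le_card N2 cstar.
have : 0 <= w * (#|C|%:R - (position N1 cstar)%:R).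
  by apply: mulr_ge0; rewrite ?subr_ge0 // ltW.
(* Raising the weight of [N1] to 1 makes [position N1 d] cancel against the bound for [M1]; the
   products with [w] are then mere atoms for [lra]. *)
have : w * (#|C|%:R - (position N1 d)%:R) <= #|C|%:R - (position N1 d)%:R.
  by rewrite ler_piMl ?subr_ge0.
lra.
Qed.
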